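(* Let $H\in\mathcal H_\star(N-1)$ be an optimal vertex algorithm and suppose that it is decomposable at $N'$, where $1\le N'\le N-1$. Then $$\rho(H)\ge N-1+\frac{N'(N'-1)}{N}.$$
   Context: Algorithms. Let $N\ge 1$ be an integer. An H-matrix of size $N-1$ is a real lower triangular matrix $H=(h_{k,j})_{1\le j\le k\le N-1}$. Given a real Hilbert space $\mathcal X$, an operator $T:\mathcal X\to\mathcal X$ and $y_0\in\mathcal X$, the algorithm defined by $H$ generates $y_{k+1}=y_k-\sum_{j=0}^{k}h_{k+1,j+1}(y_j-Ty_j)$ for $k=0,\dots,N-2$. $T$ is nonexpansive if $\|Tx-Ty\|\le\|x-y\|$ for all $x,y\in\mathcal X$; $y_\star$ is a fixed point if $Ty_\star=y_\star$. $\mathcal H_\star(N-1)$ is the set of H-matrices of size $N-1$ such that $\|y_{N-1}-Ty_{N-1}\|^2\le 4\|y_0-y_\star\|^2/N^2$ for every real Hilbert space $\mathcal X$, every nonexpansive $T:\mathcal X\to\mathcal X$ with a fixed point $y_\star$ and every $y_0\in\mathcal X$. H-certificates. For $m,j\in\{1,\dots,N-1\}$ let $Q(m,j;H)=\sum\prod_{r=1}^m h_{i(r),j(r)}$, the sum over all integers $j=j(1)\le i(1)<j(2)\le i(2)<\cdots<j(m)\le i(m)\le N-1$ (an empty sum is $0$). The H-certificates of $H$ are $\lambda^\star_{N,j}(H)=N\sum_{m=1}^{N-1}(-1)^{m-1}Q(m,j;H)$ for $1\le j\le N-1$, and $\lambda^\star_{k,j}(H)=N\sum_{\ell=1}^{N-1}\sum_{m=1}^{N-1}(-1)^{\ell+m-1}\binom{\ell+m}{m}Q(\ell,j;H)Q(m,k;H)$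 for $1\le j<k\le N-1$. Known fact (Yoon–Ryu–Grimmer): $H\in\mathcal H_\star(N-1)$ if and only if $\sum_{j=1}^{N-1}Q(k,j;H)=\frac1N\binom{N}{k+1}$ for $k=1,\dots,N-1$ and $\lambda^\star_{k,j}(H)\ge 0$ for all $1\le j<k\le N$. Vertices. An optimal vertex algorithm (vertex of $\mathcal H_\star(N-1)$) is an $H\in\mathcal H_\star(N-1)$ such that for each $j=1,\dots,N-1$ there is exactly one index $k(j)\in\{j+1,\dots,N\}$ with $\lambda^\star_{k(j),j}(H)>0$. Decomposability. $H\in\mathcal H_\star(N-1)$ is decomposable at $N'\in\{1,\dots,N-1\}$ if (i) $\lambda^\star_{N,N'}(H)>0$ and $\lambda^\star_{k,N'}(H)=0$ for $k=N'+1,\dots,N-1$, and (ii) $\lambda^\star_{k,j}(H)=0$ for all $j=1,\dots,N'-1$ and $k=N'+1,\dots,N$. Robustness measure. $\rho(H)=\sum_{j=1}^{N-1}\sum_{k=j+1}^{N}\lambda^\star_{k,j}(H)$. *)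

(* Defs.v *)
From mathcomp Require Import all_boot all_order all_algebra.
From mathcomp Require Import sesquilinear.
From mathcomp Require Import all_classical all_reals all_analysis.

Set Implicit Arguments.
Unset Strict Implicit.
Unset Printing Implicit Defensive.

Import Order.TTheory GRing.Theory Num.Theory.
Import numFieldNormedType.Exports.
Local Open Scope ring_scope.

(* A Hilbert space is a complete normed space satisfying this predicate. *)
Definition norm_from_inner (R : realType) (X : normedModType R) : Prop :=
  exists ip : {dot X for (@idfun R)}, forall x : X, `|x| ^+ 2 = ip x x.

Definition nonexpansive (R : realType) (X : normedModType R) (T : X -> X) :
  Prop := forall x y : X, `|T x - T y| <= `|x - y|.

(* An H-matrix of size N - 1 is a lower triangular H : 'M[R]_(N.-1). Rows and
   columns are numbered from 0 here, so that h_{k+1,j+1} is H k j. *)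
Definition iterates (R : realType) (N : nat) (H : 'M[R]_(N.-1))
    (X : lmodType R) (T : X -> X) (y : nat -> X) : Prop :=
  forall k : 'I_(N.-1),
    y k.+1 = y k - \sum_(j < N.-1 | (j <= k)%N) H k j *: (y j - T (y j)).

Definition Hstar (R : realType) (N : nat) (H : 'M[R]_(N.-1)) : Prop :=
  is_trig_mx H /\
  forall (X : completeNormedModType R) (T : X -> X) (ystar : X) (y : nat -> X),
    norm_from_inner X -> nonexpansive T -> T ystar = ystar ->
    iterates H T y ->
    `|y N.-1 - T (y N.-1)| ^+ 2 <= 4 * `|y 0%N - ystar| ^+ 2 / N%:R ^+ 2.

(* (I, J) is the chain i(r+1) = (I r).+1, j(r+1) = (J r).+1 for r < m. *)
Definition chain (n m j : nat) (I J : {ffun 'I_m -> 'I_n}) : bool :=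
  [&& [forall r : 'I_m, ((r : nat) == 0%N) ==> ((J r).+1 == j)],
      [forall r : 'I_m, (J r <= I r)%N] &
      [forall r : 'I_m, forall s : 'I_m,
         ((s : nat) == r.+1) ==> (I r < J s)%N]].

Definition Q (R : realType) (N : nat) (H : 'M[R]_(N.-1)) (m j : nat) : R :=
  \sum_(p : {ffun 'I_m -> 'I_(N.-1)} * {ffun 'I_m -> 'I_(N.-1)}
        | chain j p.1 p.2)
    \prod_(r < m) H (p.1 r) (p.2 r).

(* Here k and j are numbered from 1; only 1 <= j < k <= N is meaningful. *)
Definition hcert (R : realType) (N : nat) (H : 'M[R]_(N.-1)) (k j : nat) : R :=
  if k == N then N%:R * \sum_(1 <= m < N) (-1) ^+ (m - 1) * Q H m j
  else N%:R * \sum_(1 <= l < N) \sum_(1 <= m < N)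
         (-1) ^+ (l + m - 1) * 'C(l + m, m)%:R * Q H l j * Q H m k.

Definition vertex (R : realType) (N : nat) (H : 'M[R]_(N.-1)) : Prop :=
  Hstar H /\
  forall j : nat, (1 <= j < N)%N ->
    exists! k : nat, (j < k <= N)%N /\ 0 < hcert H k j.

Definition decomposable_at (R : realType) (N : nat) (H : 'M[R]_(N.-1))
    (N' : nat) : Prop :=
  [/\ Hstar H,
      (1 <= N' < N)%N,
      0 < hcert H N N' /\
        (forall k : nat, (N' < k < N)%N -> hcert H k N' = 0)
    & forall j k : nat, (1 <= j < N')%N -> (N' < k <= N)%N -> hcert H k j = 0].

Definition rho (R : realType) (N : nat) (H : 'M[R]_(N.-1)) : R :=
  \sum_(1 <= j < N) \sum_(j.+1 <= k < N.+1) hcert H k j.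

(* Main.v *)
(* Put phi_j(z) = sum_m (-1)^m Q(m,j;H) (1-z)^m for j < N and phi_N = 1. By
   Vandermonde's identity the certificates are lambda_{k,j} = -N <phi_j, phi_k>
   for the coefficientwise inner product. These polynomials measure sensitivity:
   if an error e_j is added to the residual of the j-th iterate under a linear
   operator T, the last residual changes by sum_j phi_j(T) e_j.

   Only necessary conditions for H in H_star are used. On R^N let Z be the
   negacyclic shift and v = (1,...,1). The bound is tight for (Z, v), which
   forces sum_j phi_j = (1 + z + ... + z^(N-1))/N, hence
   sum_j lambda_{N,j} = N - 1. Composing Z with a nonexpansive map that differs
   from the identity only on a half-space containing a single iterate, and
   differentiating the bound, gives lambda_{k,j} >= 0 for j < k < N.

   Decomposability at N' makes phi_{N'} orthogonal to every phi_k with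
   N' < k < N, and phi_j, j < N', orthogonal to all phi_k, k > N'. This
   determines phi_{N'} and yields sum_{j < N'} lambda_{N',j} = N'(N'-1)/N; all
   remaining certificates are nonnegative. *)
From HB Require Import structures.
Require Import Defs.
From mathcomp Require Import all_boot all_order all_algebra.
From mathcomp Require Import sesquilinear.
From mathcomp Require Import all_classical all_reals all_analysis.
From mathcomp Require Import ring lra zify.

Set Implicit Arguments.
Unset Strict Implicit.
Unset Printing Implicit Defensive.

Import Order.TTheory GRing.Theory Num.Theory.
Import numFieldNormedType.Exports.
Local Open Scope ring_scope.

(** * Euclidean space as a Hilbert space *)

(** Row vectors already carry the max norm; the alias makes room for the Euclidean one. *)
Definition euclid (R : realType) (n : nat) : Type := 'rV[R]_n.

Section Euclid.
Variables (R : realType) (n : nat).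
Implicit Types x y z : euclid R n.

HB.instance Definition _ := GRing.Lmodule.on (euclid R n).

Definition inner x y : R := \sum_i x ord0 i * y ord0 i.

Lemma innerC x y : inner x y = inner y x.
Proof. by apply: eq_bigr => i _; rewrite mulrC. Qed.

Lemma innerDr x y z : inner x (y + z) = inner x y + inner x z.
Proof. by rewrite -big_split; apply: eq_bigr => i _; rewrite mxE mulrDr. Qed.

Lemma innerZr c x y : inner x (c *: y) = c * inner x y.
Proof. by rewrite mulr_sumr; apply: eq_bigr => i _; rewrite mxE mulrCA. Qed.

Lemma innerDl x y z : inner (x + y) z = inner x z + inner y z.
Proof. by rewrite innerC innerDr !(innerC z). Qed.

Lemma innerZl c x y : inner (c *: x) y = c * inner x y.
Proof. by rewrite innerC innerZr innerC. Qed.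

Lemma innerNr x y : inner x (- y) = - inner x y.
Proof. by rewrite -scaleN1r innerZr mulN1r. Qed.

Lemma innerNl x y : inner (- x) y = - inner x y.
Proof. by rewrite innerC innerNr innerC. Qed.

Lemma innerBr x y z : inner x (y - z) = inner x y - inner x z.
Proof. by rewrite innerDr innerNr. Qed.

Lemma innerBl x y z : inner (x - y) z = inner x z - inner y z.
Proof. by rewrite innerDl innerNl. Qed.

Lemma inner0r x : inner x 0 = 0.
Proof. by rewrite -(scale0r (0 : euclid R n)) innerZr mul0r. Qed.

Lemma inner_ge0 x : 0 <= inner x x.
Proof. by apply: sumr_ge0 => i _; rewrite -expr2 sqr_ge0. Qed.

Lemma inner_eq0 x : inner x x = 0 -> x = 0.
Proof.
move=> /eqP; rewrite psumr_eq0 => [/allP h|i _]; last by rewrite -expr2 sqr_ge0.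
apply/rowP => i; rewrite mxE; apply/eqP.
by move/(_ i (mem_index_enum i)): h; rewrite /= mulf_eq0 orbb.
Qed.

Lemma cauchy_schwarz x y : inner x y ^+ 2 <= inner x x * inner y y.
Proof.
have [y0|yn0] := eqVneq (inner y y) 0.
  by rewrite (inner_eq0 y0) !inner0r expr0n mulr0.
have yp : 0 < inner y y by rewrite lt_def yn0 inner_ge0.
have := inner_ge0 (inner y y *: x - inner x y *: y).
rewrite !(innerBl, innerBr, innerZl, innerZr) (innerC y x) => h.
have : 0 <= inner y y * (inner x x * inner y y - inner x y ^+ 2) by nra.
by rewrite pmulr_rge0 // subr_ge0.
Qed.

Lemma euclid_ler_normD x y :
  Num.sqrt (inner (x + y) (x + y)) <=
  Num.sqrt (inner x x) + Num.sqrt (inner y y).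
Proof.
have s0 a : 0 <= Num.sqrt a :> R by exact: sqrtr_ge0.
rewrite -(@ler_pXn2r _ 2) ?nnegrE ?addr_ge0 //.
rewrite sqrrD !sqr_sqrtr ?inner_ge0 // innerDl !innerDr (innerC y x).
suff : inner x y <= Num.sqrt (inner x x) * Num.sqrt (inner y y) by lra.
rewrite -sqrtrM ?inner_ge0 //; apply: le_trans (ler_norm _) _.
by rewrite -sqrtr_sqr ler_wsqrtr // cauchy_schwarz.
Qed.

Lemma euclid_normrZ (c : R) x :
  Num.sqrt (inner (c *: x) (c *: x)) = `|c| * Num.sqrt (inner x x).
Proof.
by rewrite innerZl innerZr mulrA -expr2 sqrtrM ?sqr_ge0 // sqrtr_sqr.
Qed.

Lemma euclid_normr0_eq0 x : Num.sqrt (inner x x) = 0 -> x = 0.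
Proof.
move/eqP; rewrite sqrtr_eq0 => h; apply: inner_eq0.
by apply/eqP; rewrite eq_le h inner_ge0.
Qed.

HB.instance Definition _ := @Lmodule_isNormed.Build R (euclid R n)
  (fun x => Num.sqrt (inner x x)) euclid_ler_normD euclid_normrZ
  euclid_normr0_eq0.

Lemma euclid_normE x : `|x| ^+ 2 = inner x x.
Proof. by rewrite /Num.norm /= sqr_sqrtr // inner_ge0. Qed.

Lemma ler_euclid_norm x y : (`|x| <= `|y|) = (inner x x <= inner y y).
Proof. by rewrite -!euclid_normE ler_pXn2r ?nnegrE ?normr_ge0. Qed.

Lemma coord_le_euclid_norm x i : `|x ord0 i| <= `|x|.
Proof.
rewrite -(@ler_pXn2r _ 2) ?nnegrE ?normr_ge0 //.
rewrite euclid_normE real_normK ?num_real //.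
rewrite /inner (bigD1 i) //= -expr2 lerDl sumr_ge0 // => j _.
by rewrite -expr2 sqr_ge0.
Qed.

Lemma euclid_norm_le_sum x : `|x| <= \sum_i `|x ord0 i|.
Proof.
rewrite -(@ler_pXn2r _ 2) ?nnegrE ?normr_ge0 ?sumr_ge0 // euclid_normE.
rewrite expr2 mulr_suml ler_sum // => i _.
rewrite -[leLHS]expr2 -[leLHS]real_normK ?num_real // expr2 ler_wpM2l //.
by rewrite (bigD1 i) //= lerDl sumr_ge0.
Qed.

Local Open Scope classical_set_scope.

(** Each coordinate is dominated by the norm, so the coordinates converge separately; the norm is
    dominated by the sum of their absolute values, so they converge jointly. *)
Lemma euclid_cauchy_cvg (F : set_system (euclid R n)) :
  ProperFilter F -> cauchy F -> cvg F.
Proof.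
move=> FF /cauchyP Fc.
have coord_cvg (i : 'I_n) : cvg ((fun x : euclid R n => x ord0 i : R) @ F).
  apply: cauchy_cvg; apply/cauchyP => e e0.
  have [x Fx] := Fc e e0; exists (x ord0 i).
  apply: (@filterS _ F _ (ball x e)) => // y; rewrite -!ball_normE /=.
  apply: le_lt_trans.
  by have := coord_le_euclid_norm (x - y) i; rewrite !mxE.
pose l : euclid R n :=
  \row_i (lim ((fun x : euclid R n => x ord0 i : R) @ F) : R).
apply/cvg_ex; exists l; apply/cvgrPdist_lt => e e0.
(* With [n.+1] the sum of the [n] bounds stays strictly below [e], even for [n = 0]. *)
have e'0 : 0 < e / n.+1%:R by rewrite divr_gt0 ?ltr0Sn.
have : \forall x \near F,
    forall i : 'I_n, `|l ord0 i - (x : euclid R n) ord0 i| < e / n.+1%:R.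
  apply: filter_forall => i.
  by move/cvgrPdist_lt : (coord_cvg i) => /(_ _ e'0); rewrite mxE; apply.
apply: filterS => x xl; apply: le_lt_trans (euclid_norm_le_sum _) _.
apply: (@le_lt_trans _ _ (\sum_(i < n) (e / n.+1%:R))).
  apply: ler_sum => i _; rewrite !mxE; apply: ltW.
  by have := xl i; rewrite !mxE.
rewrite sumr_const card_ord -mulrnAr -[ltRHS]mulr1 ltr_pM2l //.
by rewrite -[X in X < _]mulr_natl ltr_pdivrMr ?ltr0Sn // mul1r ltr_nat.
Qed.

HB.instance Definition _ :=
  Uniform_isComplete.Build (euclid R n) euclid_cauchy_cvg.

Local Lemma inner_bilinear : bilinear_for *%R (idfun \; *%R) inner.
Proof.
split=> [y c x x'|x c y y'] /=.
  by rewrite innerDl innerZl.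
by rewrite innerDr innerZr.
Qed.
HB.instance Definition _ :=
  bilinear_isBilinear.Build R _ _ _ _ _ inner inner_bilinear.
Local Lemma inner_hermitian x y : inner x y = (-1) ^+ false * idfun (inner y x).
Proof. by rewrite expr0 mul1r innerC. Qed.
HB.instance Definition _ :=
  isHermitianSesquilinear.Build R _ false idfun inner inner_hermitian.
Local Lemma inner_definite x : x != 0 -> 0 < inner x x.
Proof.
move=> x0; rewrite lt_def inner_ge0 andbT.
by apply: contra_neq x0 => /inner_eq0.
Qed.
HB.instance Definition _ := isDotProduct.Build R _ inner inner_definite.

Lemma euclid_norm_from_inner : norm_from_inner (euclid R n).
Proof. by exists (inner : {dot _ for _}) => x; rewrite euclid_normE. Qed.

End Euclid.

(** * Splitting off the first link of a chain *)

Section FinfunCons.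
Variables (T : finType) (m : nat).

Definition fcons (a : T) (f : {ffun 'I_m -> T}) : {ffun 'I_m.+1 -> T} :=
  [ffun r => oapp f a (unlift ord0 r)].

Lemma fcons0 a f : fcons a f ord0 = a.
Proof. by rewrite ffunE unlift_none. Qed.

Lemma fconsS a f r : fcons a f (lift ord0 r) = f r.
Proof. by rewrite ffunE liftK. Qed.

Lemma fcons_bij : bijective (fun p : T * {ffun 'I_m -> T} => fcons p.1 p.2).
Proof.
exists (fun g : {ffun 'I_m.+1 -> T} => (g ord0, [ffun r => g (lift ord0 r)])).
  case=> a f /=; rewrite fcons0; congr pair.
  by apply/ffunP => r; rewrite ffunE fconsS.
move=> g /=; apply/ffunP => r; case: (unliftP ord0 r) => [s|] ->.
  by rewrite fconsS ffunE.
by rewrite fcons0.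
Qed.

End FinfunCons.

Lemma forall_ord_recl m (P : pred 'I_m.+1) :
  [forall r, P r] = P ord0 && [forall r, P (lift ord0 r)].
Proof.
apply/forallP/andP => [h|[h0 /forallP h] r]; first by split; [|apply/forallP].
by case: (unliftP ord0 r) => [s|] ->.
Qed.

Lemma forall_ord0 m (P : pred 'I_m.+1) :
  [forall r : 'I_m.+1, ((r : nat) == 0%N) ==> P r] = P ord0.
Proof.
rewrite forall_ord_recl /= [X in _ && X](_ : _ = true) ?andbT //.
exact/forallP.
Qed.

Lemma chain_fcons n m j (i0 j0 : 'I_n) (I J : {ffun 'I_m -> 'I_n}) :
  chain j (fcons i0 I) (fcons j0 J) =
  [&& j0.+1 == j, (j0 <= i0)%N,
      [forall s : 'I_m, ((s : nat) == 0%N) ==> (i0 < J s)%N],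
      [forall r, (J r <= I r)%N] &
      [forall r : 'I_m, forall s : 'I_m,
         ((s : nat) == r.+1) ==> (I r < J s)%N]].
Proof.
rewrite /chain !forall_ord_recl /= !fcons0.
have -> : [forall r : 'I_m,
    (lift ord0 r == 0 :> nat) ==> ((fcons j0 J (lift ord0 r)).+1 == j)].
  by apply/forallP.
have -> : [forall r, (fcons j0 J (lift ord0 r) <= fcons i0 I (lift ord0 r))%N]
    = [forall r, (J r <= I r)%N].
  by apply: eq_forallb => r; rewrite !fconsS.
have -> : [forall s : 'I_m,
    (lift ord0 s == 1 :> nat) ==> (i0 < fcons j0 J (lift ord0 s))%N]
    = [forall s : 'I_m, ((s : nat) == 0%N) ==> (i0 < J s)%N].
  by apply: eq_forallb => s; rewrite fconsS lift0.
have -> : [forall r : 'I_m, forall s : 'I_m.+1,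
      (s == (lift ord0 r).+1 :> nat) ==>
      (fcons i0 I (lift ord0 r) < fcons j0 J s)%N]
    = [forall r : 'I_m, forall s : 'I_m,
         ((s : nat) == r.+1) ==> (I r < J s)%N].
  apply: eq_forallb => r; rewrite forall_ord_recl /=.
  by apply: eq_forallb => s; rewrite !fconsS.
by rewrite andbT -!andbA; do !bool_congr.
Qed.

(** * The polynomials [phi] and the response to errors *)

Section HMatrix.
Variables (R : realType) (n : nat) (H : 'M[R]_n).
Local Notation QH := (@Q R n.+1 H).

Lemma Q_fcons m j : QH m.+1 j =
  \sum_(i0 : 'I_n) \sum_(j0 : 'I_n)
    \sum_(p : {ffun 'I_m -> 'I_n} * {ffun 'I_m -> 'I_n} |
          chain j (fcons i0 p.1) (fcons j0 p.2))
     (H i0 j0 * \prod_(r < m) H (p.1 r) (p.2 r)).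
Proof.
have [g gK Kg] := fcons_bij 'I_n m.
rewrite /Q pair_bigA /= pair_big_dep /=.
rewrite (reindex (fun q : ('I_n * 'I_n) *
    ({ffun 'I_m -> 'I_n} * {ffun 'I_m -> 'I_n}) =>
    (fcons q.1.1 q.2.1, fcons q.1.2 q.2.2))) /=.
  apply: eq_bigr => -[[i0 j0] [I J]] _ /=; rewrite big_ord_recl !fcons0.
  by congr (_ * _); apply: eq_bigr => r _; rewrite !fconsS.
exists (fun p => (((g p.1).1, (g p.2).1), ((g p.1).2, (g p.2).2))).
  by case=> [[i0 j0] [I J]] _; rewrite /= (gK (i0, I)) (gK (j0, J)).
by case=> [I J] _ /=; rewrite Kg Kg.
Qed.

Lemma Q1 (j : 'I_n) : QH 1 j.+1 = \sum_(i < n | (j <= i)%N) H i j.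
Proof.
rewrite Q_fcons [RHS]big_mkcond; apply: eq_bigr => i0 _ /=.
rewrite (bigD1 j) //= [X in _ + X]big1 => [|j0 ne]; last first.
  rewrite big_pred0 // => p.
  by rewrite chain_fcons eqSS (inj_eq val_inj) (negPf ne).
rewrite addr0; case: ifP => le.
  under eq_bigr => p _ do rewrite big_ord0 mulr1.
  rewrite (eq_bigl (fun p => p \in predT)) => [|p]; last first.
    rewrite chain_fcons eqxx le /=.
    by apply/and3P; split; apply/forallP => -[].
  by rewrite sumr_const card_prod card_ffun !card_ord expn0 mulr1n.
by rewrite big_pred0 // => p; rewrite chain_fcons le andbF.
Qed.

(** What follows the first link [(i, j)] is a nonempty chain starting in some column [j' > i]; [Q1]
    is the base case. *)
Lemma QS m (j : 'I_n) : QH m.+2 j.+1 =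
  \sum_(i < n | (j <= i)%N) H i j * \sum_(j' < n | (i < j')%N) QH m.+1 j'.+1.
Proof.
rewrite Q_fcons [RHS]big_mkcond; apply: eq_bigr => i0 _ /=.
rewrite (bigD1 j) //= [X in _ + X]big1 => [|j0 ne]; last first.
  rewrite big_pred0 // => p.
  by rewrite chain_fcons eqSS (inj_eq val_inj) (negPf ne).
rewrite addr0; case: ifP => le; last first.
  by rewrite big_pred0 // => p; rewrite chain_fcons le andbF.
(* [J ord0] fixes the column [j'], so after the exchange the inner sum has at most one term. *)
rewrite -mulr_sumr; congr (_ * _); rewrite /Q (exchange_big_dep xpredT) //=.
rewrite big_mkcond; apply: eq_bigr => -[I J] _ /=.
rewrite chain_fcons eqxx le /= forall_ord0.
under [RHS]eq_bigl => j'.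
  rewrite /chain forall_ord0 eqSS (inj_eq val_inj) eq_sym andbCA.
  over.
by rewrite [RHS]big_mkcondr big_pred1_eq.
Qed.

(** Columns strictly increase along a chain, so [m + 1] links from column [j] would reach column
    [j + m] or later, outside the matrix. *)
Lemma Q_eq0 m (j : 'I_n) : (n <= m + j)%N -> QH m.+1 j.+1 = 0.
Proof.
elim: m j => [|m IH] j nj; first by rewrite leqNgt ltn_ord in nj.
rewrite QS big1 // => i ji; rewrite big1 ?mulr0 // => j' ij'.
by rewrite IH //; lia.
Qed.

(* [phi j] belongs to the index [j + 1] of the paper. *)
Definition phi (j : nat) : {poly R} :=
  if j == n then 1 else \sum_(m < n) QH m.+1 j.+1 *: ('X - 1) ^+ m.+1.

Lemma phi_last : phi n = 1.
Proof. by rewrite /phi eqxx. Qed.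

Lemma phiE (k : 'I_n) :
  phi k = \sum_(m < n) QH m.+1 k.+1 *: ('X - 1) ^+ m.+1.
Proof. by rewrite /phi ltn_eqF. Qed.

(** This is [Q1] and [QS] summed over chain lengths: the first link contributes [('X - 1) * H i j],
    the rest [phi j'], and [phi n = 1] stands for stopping after one link. *)
Lemma phi_rec (j : 'I_n) : phi j = ('X - 1) *
  \sum_(i < n | (j <= i)%N) H i j *: \sum_(j' < n.+1 | (i < j')%N) phi j'.
Proof.
have -> : phi j = \sum_(m < n.+1) QH m.+1 j.+1 *: ('X - 1) ^+ m.+1.
  by rewrite phiE big_ord_recr /= Q_eq0 ?leq_addr // scale0r addr0.
rewrite big_ord_recl expr1 Q1 /=.
under [X in _ + X]eq_bigr => m _.
  rewrite QS scaler_suml exprS.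
  under eq_bigr => i _ do rewrite -scalerA scalerAr.
  over.
rewrite scaler_suml [X in _ + X]exchange_big -big_split mulr_sumr /=.
apply: eq_bigr => i ji.
rewrite [in RHS]big_mkcond big_ord_recr /= ltn_ord -big_mkcond /=.
rewrite phi_last -[RHS]scalerAr mulrDr mulr1 [RHS]scalerDr addrC.
congr (_ + _).
rewrite -scaler_sumr; congr (_ *: _).
under [in RHS]eq_bigr => k _ do rewrite phiE.
rewrite [in RHS]exchange_big /= mulr_sumr; apply: eq_bigr => m _.
by rewrite -scaler_suml -scalerAr.
Qed.

Lemma size_phi j : (j <= n)%N -> (size (phi j) <= n.+1 - j)%N.
Proof.
move=> jn; rewrite /phi; case: eqP => [->|nj].
  by rewrite size_polyC oner_eq0; lia.
have jn' : (j < n)%N by lia.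
apply: (leq_trans (size_sum _ _ _)); apply/bigmax_leqP => m _.
have [h|h] := leqP n (m + j).
  by rewrite (@Q_eq0 m (Ordinal jn')) // scale0r size_poly0.
by apply: (leq_trans (size_scale_leq _ _)); rewrite -polyC1 size_exp_XsubC; lia.
Qed.

Lemma phi1 j : (j < n)%N -> (phi j).[1] = 0.
Proof.
move=> jn; rewrite (phi_rec (Ordinal jn)) hornerM !hornerE.
by rewrite subrr mul0r.
Qed.

(** By [iterates_last] this is the polynomial [p n] below: for linear [T], the last iterate is
    [Phi(T) y_0]. *)
Definition Phi := \sum_(j < n.+1) phi j.

(* Abel summation against [phi_rec]: replacing each residual [(1 - z) y_j] by
   [(1 - z) y_j + e_j] changes the last residual by [\sum_j phi_j e_j], as
   [phi_n = 1]. *)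
Lemma response (y e : nat -> {poly R}) :
  (forall k : 'I_n, y k.+1 = y k -
     \sum_(j < n | (j <= k)%N) H k j *: ((1 - 'X) * y j + e j)) ->
  (1 - 'X) * y n + e n = (1 - 'X) * Phi * y 0%N + \sum_(j < n.+1) phi j * e j.
Proof.
move=> hy; pose r j := (1 - 'X) * y j + e j.
have step : \sum_(j < n) phi j * r j =
    (1 - 'X) * \sum_(j < n.+1) phi j * (y j - y 0%N).
  under eq_bigr => j _ do rewrite phi_rec -mulrA mulr_suml.
  rewrite -mulr_sumr (exchange_big_dep xpredT) //= -opprB mulNr -mulrN.
  congr (_ * _); rewrite -sumrN.
  under [LHS]eq_bigr => i _.
    under eq_bigr => j _ do rewrite -scalerAl scalerAr.
    rewrite -mulr_sumr -mulrN.
    have -> : - (\sum_(j < n | (j <= i)%N) H i j *: r j) = y i.+1 - y i.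
      by rewrite hy addrAC subrr add0r.
    rewrite mulr_suml.
    over.
  rewrite (exchange_big_dep xpredT) //=; apply: eq_bigr => j _.
  rewrite -mulr_sumr; congr (_ * _).
  rewrite -(telescope_sumr _ (leq0n j)) big_mkord.
  by rewrite (big_ord_widen n (fun i => y i.+1 - y i)) // -ltnS.
have -> : \sum_(j < n.+1) phi j * e j =
    \sum_(j < n.+1) phi j * r j - (1 - 'X) * \sum_(j < n.+1) phi j * y j.
  rewrite mulr_sumr -sumrB; apply: eq_bigr => j _; rewrite /r; ring.
rewrite big_ord_recr /= step phi_last mul1r -/(r n).
have -> : \sum_(j < n.+1) phi j * (y j - y 0%N) =
    \sum_(j < n.+1) phi j * y j - Phi * y 0%N.
  by rewrite mulr_suml -sumrB; apply: eq_bigr => j _; rewrite mulrBr.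
ring.
Qed.

(** The algorithm run on multiplication by [X] from [1]; for every linear [T] the iterates are then
    [p_k(T) y_0]. *)
Definition poly_iterates (p : nat -> {poly R}) : Prop :=
  p 0%N = 1 /\ forall k : 'I_n,
    p k.+1 = p k - \sum_(j < n | (j <= k)%N) H k j *: (p j - 'X * p j).

Lemma size_iterates (p : nat -> {poly R}) :
  poly_iterates p ->
  forall k, (k <= n)%N -> (size (p k) <= k.+1)%N.
Proof.
move=> [p0 hp]; elim/ltn_ind => -[_ _|k IH kn].
  by rewrite p0 size_poly1.
have p_eq0 j s : (j <= k)%N -> (j < s)%N -> (p j)`_s = 0.
  by move=> jk js; have /leq_sizeP := IH j jk (leq_trans jk (ltnW kn)); apply.
apply/leq_sizeP => -[//|s] ks.
rewrite (hp (Ordinal kn)) coefB coef_sum (p_eq0 k) //; last lia.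
rewrite big1 ?subrr // => j jk.
have {}jk : (j <= k)%N by [].
by rewrite coefZ coefB coefXM /= !p_eq0 ?subrr ?mulr0 //; lia.
Qed.

Lemma iterates_last (p : nat -> {poly R}) :
  poly_iterates p ->
  (1 - 'X) * p n = (1 - 'X) * Phi.
Proof.
move=> [p0 hp]; have := @response p (fun=> 0); rewrite addr0 p0 mulr1 => ->.
  by rewrite big1 ?addr0 // => j _; rewrite mulr0.
move=> k; rewrite hp; congr (_ - _); apply: eq_bigr => j _.
by rewrite addr0 mulrBl mul1r.
Qed.

(* Apply [response] to the sequence of [z^s]-coefficients of the [p_j(z)], seen
   as constants in [w]: this says [\sum_j p_j(z) phi_j(w) =
   c (z^N - w^N) / (z - w)]. *)
Lemma iterates_phi (p : nat -> {poly R}) (c : R) :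
  poly_iterates p ->
  (1 - 'X) * Phi = c *: (1 - 'X^(n.+1)) ->
  forall s, (s <= n)%N -> \sum_(j < n.+1) (p j)`_s *: phi j = c *: 'X^(n - s).
Proof.
move=> [p0 hp] hPhi.
have X0 : ('X : {poly R}) != 0 by rewrite polyX_eq0.
pose F s := \sum_(j < n.+1) (p j)`_s *: phi j.
pose prev s (q : {poly R}) := if s is s'.+1 then q`_s' else 0.
have main s : ((c *: (1 - 'X^(n.+1)))`_s)%:P =
    c *: (1 - 'X^(n.+1)) * ((1 : {poly R})`_s)%:P + 'X * F s -
    (if s is s'.+1 then F s' else 0).
  have cs q : (q - 'X * q)`_s = q`_s - prev s q.
    by rewrite coefB coefXM; case: s.
  (* These errors turn the residual [(1 - w) y_k] into the [z^s]-coefficient of [(1 - z) p_k(z)],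
     which drives the recursion of the coefficients. *)
  have := @response (fun k => ((p k)`_s)%:P)
    (fun k => 'X * ((p k)`_s)%:P - (prev s (p k))%:P).
  rewrite p0 hPhi => h.
  transitivity ((1 - 'X) * ((p n)`_s)%:P +
      ('X * ((p n)`_s)%:P - (prev s (p n))%:P)).
    rewrite -hPhi -(iterates_last (conj p0 hp)) mulrBl mul1r cs polyCB; ring.
  rewrite h.
    rewrite -addrA; congr (_ + _).
    rewrite (eq_bigr (fun j : 'I_n.+1 =>
        'X * ((p j)`_s *: phi j) - prev s (p j) *: phi j)).
      rewrite sumrB -mulr_sumr; congr (_ - _).
      by case: (s) => [|s'] //=; rewrite big1 // => j _; rewrite scale0r.
    by move=> j _; rewrite -!mul_polyC; ring.
  move=> k; rewrite hp coefB polyCB; congr (_ - _).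
  rewrite coef_sum raddf_sum /=; apply: eq_bigr => j _.
  rewrite coefZ cs -mul_polyC polyCM polyCB; congr (_ * _); ring.
(* [main] reads [X F_0 = c X^(n+1)] at [s = 0] and [X F_(s+1) = F_s] afterwards; cancel [X]. *)
elim=> [_|s IH sn]; apply: (mulfI X0); rewrite -/(F _).
  have := main 0%N; rewrite coefZ coefB coefXn !coef1 /=.
  rewrite subr0 mulr1 subr0 mulr1.
  rewrite -/(F 0%N) subn0 -mul_polyC => h.
  have -> : 'X * F 0%N = c%:P - c%:P * (1 - 'X^(n.+1)) by rewrite {1}h; ring.
  by rewrite exprS -mul_polyC; ring.
have := main s.+1; rewrite coefZ coefB coefXn !coef1 /= eqSS ltn_eqF //.
rewrite subrr mulr0 polyC0 mulr0 add0r => h.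
have -> : 'X * F s.+1 = F s by rewrite -[RHS]add0r h subrK.
have -> : F s = c *: 'X^(n - s) by exact: IH (ltnW sn).
rewrite -(subnSK sn) exprS -!mul_polyC.
ring.
Qed.

End HMatrix.

(** Letting [res] depend on the index covers recursions with an error injected at a single step. *)
Lemma traj_exists (R : realType) (n : nat) (H : 'M[R]_n) (X : lmodType R)
    (res : nat -> X -> X) (y0 : X) :
  exists y : nat -> X, y 0%N = y0 /\ forall k : 'I_n,
    y k.+1 = y k - \sum_(j < n | (j <= k)%N) H k j *: res j (y j).
Proof.
suff /(_ n) [y [y00 hy]] : forall m, exists y : nat -> X, y 0%N = y0 /\
    forall k : 'I_n, (k < m)%N ->
    y k.+1 = y k - \sum_(j < n | (j <= k)%N) H k j *: res j (y j).
  by exists y; split=> // k; apply: hy.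
elim=> [|m [y [y00 hy]]]; first by exists (fun=> y0).
have [mn|nm] := ltnP m n; last first.
  by exists y; split=> // k _; apply: hy; apply: leq_trans nm.
pose z := y m - \sum_(j < n | (j <= m)%N) H (Ordinal mn) j *: res j (y j).
exists (fun i => if (i <= m)%N then y i else z); split => // k km.
have jm (j : 'I_n) : (j <= k)%N -> (j <= m)%N by lia.
rewrite (_ : (k <= m)%N = true) //.
under eq_bigr => j /jm -> do over.
have [km'|mk] := ltnP k m; first exact: hy.
have -> : k = Ordinal mn by apply: val_inj => /=; lia.
by [].
Qed.

(** * The negacyclic shift and its polynomial calculus *)

Section Negacyclic.
Variables (R : realType) (n : nat).
Local Notation E := (euclid R n.+1).
Implicit Types (x y : E) (p q : {poly R}).

(** On row vectors, [(x_0, ..., x_n)] goes to [(-x_n, x_0, ..., x_(n-1))]: multiplication by [X]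
    modulo [X^(n+1) + 1]. *)
Definition negashift : 'M[R]_n.+1 := \matrix_(i, j)
  if j == ord0 then - (i == ord_max)%:R else (i.+1 == j)%:R.

Lemma negashift0 x : (x *m negashift) ord0 ord0 = - x ord0 ord_max.
Proof.
rewrite mxE (bigD1 ord_max) //= big1 => [|i ne]; rewrite !mxE eqxx.
  by rewrite eqxx addr0 mulrN mulr1.
by rewrite (negPf ne) oppr0 mulr0.
Qed.

Lemma negashiftS x (j : 'I_n) :
  (x *m negashift) ord0 (lift ord0 j) = x ord0 (widen_ord (leqnSn n) j).
Proof.
rewrite mxE (bigD1 (widen_ord (leqnSn n) j)) //= big1 => [|i ne];
  rewrite !mxE /=.
  by rewrite eqxx addr0 mulr1.
have -> : (i.+1 == bump 0 j) = (i == widen_ord (leqnSn n) j) by [].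
by rewrite (negPf ne) mulr0.
Qed.

Lemma inner_negashift x y :
  inner (x *m negashift : E) (y *m negashift : E) = inner x y.
Proof.
rewrite /inner big_ord_recl [RHS]big_ord_recr /= addrC !negashift0 mulrNN.
by congr (_ + _); apply: eq_bigr => i _; rewrite !negashiftS.
Qed.

Definition ones : E := const_mx 1.

Lemma inner_ones x : inner ones x = \sum_i x ord0 i.
Proof. by apply: eq_bigr => i _; rewrite mxE mul1r. Qed.

Lemma inner_ones_negashift x :
  inner ones (x *m negashift : E) = inner ones x - 2 * x ord0 ord_max.
Proof.
rewrite !inner_ones big_ord_recl [in RHS]big_ord_recr /= negashift0.
under eq_bigr => i _ do rewrite negashiftS.
ring.
Qed.

Lemma negashift_exp x r (i : 'I_n.+1) : (r <= i)%N ->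
  (x *m negashift ^+ r) ord0 i = x ord0 (inord (i - r)).
Proof.
elim: r i => [|r IH] i ri; first by rewrite expr0 mulmx1 subn0 inord_val.
rewrite exprSr mulmxA; case: (unliftP ord0 i) ri => [j|] -> //.
rewrite lift0 => ri.
by rewrite negashiftS IH //= subSS.
Qed.

Definition e0 : E := delta_mx ord0 ord0.

Lemma negashift_e0 r : (r <= n)%N ->
  e0 *m negashift ^+ r = delta_mx ord0 (inord r).
Proof.
elim: r => [|r IH] rn.
  by rewrite expr0 mulmx1; congr delta_mx; apply: val_inj; rewrite /= inordK.
rewrite exprSr mulmxA (IH (ltnW rn)).
apply/rowP => i.
case: (unliftP ord0 i) => [j|] ->.
  rewrite negashiftS !mxE !eqxx -!(inj_eq val_inj) /= !inordK //; lia.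
rewrite negashift0 !mxE !eqxx -!(inj_eq val_inj) /= !inordK ?oppr0 //; last lia.
by rewrite gtn_eqF ?oppr0 //.
Qed.

Definition act p x : E := x *m horner_mx negashift p.

Lemma act1 x : act 1 x = x.
Proof. by rewrite /act rmorph1 mulmx1. Qed.

Lemma actX x : act 'X x = x *m negashift.
Proof. by rewrite /act horner_mx_X. Qed.

Lemma actM p q x : act (p * q) x = act p (act q x).
Proof. by rewrite /act mulrC rmorphM mulmxA. Qed.

Lemma actB p q x : act (p - q) x = act p x - act q x.
Proof. by rewrite /act rmorphB mulmxBr. Qed.

Lemma actD p q x : act (p + q) x = act p x + act q x.
Proof. by rewrite /act rmorphD mulmxDr. Qed.

Lemma act0 x : act 0 x = 0.
Proof. by rewrite /act rmorph0 mulmx0. Qed.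

Lemma actZ c p x : act (c *: p) x = c *: act p x.
Proof. by rewrite /act linearZ /= scalemxAr. Qed.

Lemma act_sum (I : Type) (r : seq I) (P : pred I) (F : I -> {poly R}) x :
  act (\sum_(i <- r | P i) F i) x = \sum_(i <- r | P i) act (F i) x.
Proof.
by elim/big_rec2: _ => [|i a b _ <-]; rewrite ?act0 ?actD.
Qed.

Lemma actZr c p x : act p (c *: x) = c *: act p x.
Proof. by rewrite /act scalemxAl. Qed.

Lemma actE p x : (size p <= n.+1)%N ->
  act p x = \sum_(r < n.+1) p`_r *: (x *m negashift ^+ r : E).
Proof.
move=> sp; have {1}-> : p = \sum_(r < n.+1) p`_r *: 'X^r.
  rewrite -poly_def; apply/polyP => i; rewrite coef_poly; case: ltnP => // ni.
  by rewrite nth_default // (leq_trans sp).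
rewrite act_sum; apply: eq_bigr => r _.
by rewrite actZ /act rmorphXn /= horner_mx_X.
Qed.

Lemma act_last p x : (size p <= n.+1)%N ->
  act p x ord0 ord_max = \sum_(r < n.+1) p`_r * x ord0 (inord (n - r)).
Proof.
move=> sp; rewrite actE // summxE; apply: eq_bigr => r _.
by rewrite mxE negashift_exp ?leq_ord.
Qed.

Lemma act_e0 p : (size p <= n.+1)%N -> act p e0 = \row_i p`_i.
Proof.
move=> sp; rewrite actE //; apply/rowP => i; rewrite summxE mxE.
rewrite (bigD1 i) //= big1 => [|j ne].
  by rewrite mxE negashift_e0 ?leq_ord // inord_val mxE !eqxx mulr1 addr0.
rewrite mxE negashift_e0 ?leq_ord // inord_val mxE eqxx /=.
by rewrite eq_sym (negPf ne) mulr0.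
Qed.

Lemma act_1subX p x : act ((1 - 'X) * p) x = act p x - act p x *m negashift.
Proof. by rewrite actM actB act1 actX. Qed.

Lemma act_1subX_ones : act (1 - 'X) ones = 2 *: e0.
Proof.
rewrite actB act1 actX; apply/rowP => i; rewrite mxE [in X in _ + X]mxE.
case: (unliftP ord0 i) => [j|] ->.
  by rewrite negashiftS !mxE subrr eqxx /= mulr0.
by rewrite negashift0 !mxE !eqxx opprK mulr1.
Qed.

(** Since [(1 - Z) v = 2 e0] and the shifts of [e0] are the standard basis, the action on [v]
    displays the coefficients. *)
Lemma act_1subX_onesM p : (size p <= n.+1)%N ->
  act ((1 - 'X) * p) ones = 2 *: (\row_i p`_i : E).
Proof. by move=> sp; rewrite mulrC actM act_1subX_ones actZr act_e0. Qed.

(** Pairing [y - Z y] with [v] leaves twice the last coordinate of [y]; shifts by at most [n] bring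
    no sign change there. *)
Lemma inner_ones_1subX p x : (size p <= n.+1)%N ->
  inner ones (act ((1 - 'X) * p) x) =
  2 * \sum_(r < n.+1) p`_r * x ord0 (inord (n - r)).
Proof.
move=> sp; rewrite act_1subX innerBr inner_ones_negashift act_last //; ring.
Qed.

Lemma inner_ones_ones : inner ones ones = n.+1%:R.
Proof.
rewrite inner_ones; under eq_bigr => i _ do rewrite mxE.
by rewrite sumr_const card_ord.
Qed.

End Negacyclic.

(** * What tightness for the shift forces *)

Section Necessity.
Variables (R : realType) (n : nat) (H : 'M[R]_n).
Hypothesis hH : @Hstar R n.+1 H.
Local Notation E := (euclid R n.+1).
Local Notation phi := (phi H).
Local Notation Z := (negashift R n).
Local Notation v := (ones R n).

Lemma poly_iterates_exists : exists p, poly_iterates H p.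
Proof. exact: (@traj_exists _ _ H _ (fun=> fun q => q - 'X * q) 1). Qed.

Lemma Hstar_bound (T : E -> E) (y : nat -> E) :
  nonexpansive T -> T 0 = 0 -> @iterates R n.+1 H E T y -> y 0%N = v ->
  inner (y n - T (y n)) (y n - T (y n)) <= 4 / n.+1%:R.
Proof.
move=> Tne T0 hy y0.
have := hH.2 E T 0 y (@euclid_norm_from_inner R n.+1) Tne T0 hy.
rewrite subr0 y0 !euclid_normE inner_ones_ones /=.
suff -> : 4 * n.+1%:R / n.+1%:R ^+ 2 = 4 / n.+1%:R :> R by [].
have n0 : (n.+1%:R : R) != 0 by rewrite pnatr_eq0.
by field.
Qed.

Lemma size_Phi : (size (Phi H) <= n.+1)%N.
Proof.
apply: (leq_trans (size_sum _ _ _)); apply/bigmax_leqP => j _.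
by apply: (leq_trans (size_phi H _)); have := ltn_ord j; lia.
Qed.

Lemma Phi1 : (Phi H).[1] = 1.
Proof.
rewrite /Phi big_ord_recr /= hornerD phi_last hornerC horner_sum big1 ?add0r //.
by move=> j _; rewrite phi1.
Qed.

Lemma act_iterates p : poly_iterates H p ->
  @iterates R n.+1 H E (fun x => x *m Z) (fun k => act (p k) v).
Proof.
move=> [_ hp] k; rewrite hp actB act_sum; congr (_ - _).
apply: eq_bigr => j _; rewrite actZ; congr (_ *: _).
by rewrite actB [X in _ - X]actM actX.
Qed.

(* With [g := (1 - X) Phi], the worst-case bound is attained along [v]:
   [<v, g(Z) v> = 2], so the equality case of Cauchy-Schwarz forces
   [g(Z) v = (2/N) v]. *)
Lemma act_Phi_ones : act ((1 - 'X) * Phi H) v = (2 / n.+1%:R) *: v.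
Proof.
have [p hp] := poly_iterates_exists; have [p0 _] := hp.
set r := act _ v.
have Nn0 : (n.+1%:R : R) != 0 by rewrite pnatr_eq0.
have vr : inner v r = 2.
  rewrite inner_ones_1subX ?size_Phi //; transitivity (2 * (Phi H).[1]).
    rewrite (horner_coef_wide 1 size_Phi); congr (_ * _).
    by apply: eq_bigr => i _; rewrite mxE expr1n.
  by rewrite Phi1 mulr1.
have rr : inner r r <= 4 / n.+1%:R.
  have <- : act (p n) v - act (p n) v *m Z = r.
    by rewrite -act_1subX (iterates_last hp).
  apply: (@Hstar_bound (fun x => x *m Z) (fun k => act (p k) v)).
  - move=> x y; rewrite ler_euclid_norm -(inner_negashift (x - y)).
    by rewrite mulmxBl.
  - by rewrite mul0mx.
  - exact: act_iterates.
  - by rewrite p0 act1.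
apply/eqP; rewrite -subr_eq0; apply/eqP/inner_eq0/le_anti.
rewrite inner_ge0 andbT !(innerBr, innerBl, innerZr, innerZl) (innerC r) vr.
rewrite inner_ones_ones.
suff -> : 2 / n.+1%:R * 2 - 2 / n.+1%:R * (2 / n.+1%:R * n.+1%:R) = 0 :> R.
  rewrite subr0 [2 / _ * 2](_ : _ = 4 / n.+1%:R) ?subr_le0 //.
  by field.
by field.
Qed.

Lemma coef_Phi i : (i <= n)%N -> (Phi H)`_i = n.+1%:R^-1.
Proof.
move=> ni; have Nn0 : (n.+1%:R : R) != 0 by rewrite pnatr_eq0.
have := act_Phi_ones; rewrite act_1subX_onesM ?size_Phi //.
move/rowP/(_ (inord i)); rewrite !mxE inordK ?ltnS // mulr1 => h.
have two : (2 : R) != 0 by rewrite pnatr_eq0.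
by apply: (mulfI two); rewrite h.
Qed.

Lemma PhiE : (1 - 'X) * Phi H = n.+1%:R^-1 *: (1 - 'X^(n.+1)).
Proof.
have -> : Phi H = n.+1%:R^-1 *: \sum_(i < n.+1) 'X^i.
  apply/polyP => i.
  have [ni|ni] := ltnP i n.+1.
    rewrite coef_Phi // coefZ coef_sum (bigD1 (Ordinal ni)) //= coefXn eqxx.
    rewrite big1 ?addr0 ?mulr1 // => j ne; rewrite coefXn.
    by rewrite -[i]/(val (Ordinal ni)) (inj_eq val_inj) eq_sym (negPf ne).
  rewrite nth_default ?(leq_trans size_Phi) // coefZ coef_sum.
  rewrite big1 ?mulr0 // => j _.
  by rewrite coefXn gtn_eqF // (leq_trans (ltn_ord j)).
rewrite -scalerAr; congr (_ *: _).
by rewrite -opprB mulNr -subrX1 opprB.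
Qed.

(** [iterates_phi] with [c = 1/N] says [A *m B = 1]; a one-sided inverse of a square matrix is
    two-sided, and [B *m A = 1] is the claim. *)
Lemma dual_basis p (i j : 'I_n.+1) : poly_iterates H p ->
  \sum_(s < n.+1) n.+1%:R * (phi j)`_s * (p i)`_(n - s) = (i == j)%:R.
Proof.
move=> hp; have Nn0 : (n.+1%:R : R) != 0 by rewrite pnatr_eq0.
pose A : 'M[R]_n.+1 := \matrix_(r, j) (n.+1%:R * (p j)`_(n - r)).
pose B : 'M[R]_n.+1 := \matrix_(j, t) (phi j)`_t.
have AB : A *m B = 1%:M.
  apply/matrixP => r t; rewrite !mxE.
  have := iterates_phi hp PhiE (leq_subr r n).
  rewrite subKn ?leq_ord // => /(congr1 (fun q : {poly R} => n.+1%:R * q`_t)).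
  rewrite coefZ mulrA mulfV // mul1r coefXn coef_sum mulr_sumr.
  rewrite [t == r :> nat]eq_sym => <-; apply: eq_bigr => k _.
  by rewrite !mxE coefZ mulrA.
have /matrixP/(_ j i) := mulmx1C AB; rewrite !mxE eq_sym => <-.
by apply: eq_bigr => s _; rewrite !mxE; ring.
Qed.

Definition dotp (p q : {poly R}) : R := \sum_(r < n.+1) p`_r * q`_r.

(** [Z] is an isometry. The map after it pushes points with [<a, x> < 0] towards the half-space
    [<a, x> >= 0], without overshooting as [d |a|^2 <= 1]. *)
Lemma hinge_nonexpansive (d : R) (a : E) : 0 <= d -> d * inner a a <= 1 ->
  nonexpansive (fun x : E =>
    (x *m Z : E) - (d * Num.min (inner a (x *m Z)) 0) *: a : E).
Proof.
move=> d0 da x y; rewrite ler_euclid_norm -(inner_negashift (x - y)) mulmxBl.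
move: (x *m Z) (y *m Z) => {}x {}y.
set s := inner a x; set t := inner a y.
pose m := Num.min s 0 - Num.min t 0.
have -> : x - (d * Num.min s 0) *: a - (y - (d * Num.min t 0) *: a) =
    (x - y : E) - (d * m) *: a.
  by apply/rowP => i; rewrite !mxE /m; ring.
(* [min(., 0)] is nondecreasing and 1-Lipschitz. The cross term is thus at most [- 2 d m^2], which
   outweighs [d^2 m^2 |a|^2 <= d m^2]. *)
have mw : m ^+ 2 <= m * (s - t).
  rewrite /m /Num.min; case: (ltP s 0) => s0; case: (ltP t 0) => t0; nra.
have wE : inner a (x - y) = s - t by rewrite innerBr.
rewrite !(innerBl _ (_ *: a)) !(innerBr _ _ (_ *: a)) !innerZl !innerZr.
rewrite (innerC (x - y) a) wE.
have dm0 : 0 <= d * m ^+ 2 by rewrite mulr_ge0 ?sqr_ge0.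
have : d * m ^+ 2 * (d * inner a a) <= d * m ^+ 2 by rewrite ler_piMr.
have : d * m ^+ 2 <= d * (m * (s - t)) by rewrite ler_wpM2l.
move: dm0.
move: (inner a a) (inner (x - y) _) => A B; nra.
Qed.

End Necessity.

(** * Signs of the inner products by perturbing the shift *)

Section Nonneg.
Variables (R : realType) (n : nat) (H : 'M[R]_n).
Hypothesis hH : @Hstar R n.+1 H.
Local Notation E := (euclid R n.+1).
Local Notation phi := (phi H).
Local Notation Z := (negashift R n).
Local Notation v := (ones R n).
Local Notation dotp := (@dotp R n).

(* For [b := probe tau], the vector [a := (Z b - b) / 2] satisfies
   [<a, Z y_i> = tau_i] along the linear trajectory [y_i]. *)
Definition probe (tau : nat -> R) : E :=
  \row_s (n.+1%:R * \sum_(j < n.+1) tau j * (phi j)`_(n - s)).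

(** By isometry the left side is half of [<b, (1 - Z) p_i(Z) v>], the pairing of [b] with the
    coefficients of [p_i]; [dual_basis] extracts [tau i]. *)
Lemma inner_probe tau p (i : 'I_n.+1) : poly_iterates H p ->
  inner (2^-1 *: ((probe tau : E) *m Z - probe tau) : E) (act (p i) v *m Z : E)
  = tau i.
Proof.
move=> hp; set b := probe tau; set x := act (p i) v.
have sp : (size (p i) <= n.+1)%N.
  apply: leq_trans (size_iterates hp _) _; [exact: leq_ord|exact: ltn_ord].
rewrite innerZl innerBl inner_negashift -innerBr /x -act_1subX.
rewrite act_1subX_onesM // innerZr mulrA mulVf ?mul1r ?pnatr_eq0 //.
rewrite /inner (reindex_inj rev_ord_inj) /=.
under eq_bigr => s _.
  rewrite !mxE /= subSS subKn ?leq_ord // mulr_sumr mulr_suml.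
  over.
rewrite exchange_big /= (bigD1 i) //= [X in _ + X]big1 => [|j ji].
  rewrite addr0; transitivity (tau i * (i == i)%:R); last by rewrite eqxx mulr1.
  rewrite -(dual_basis hH i i hp) mulr_sumr; apply: eq_bigr => s _; ring.
transitivity (tau j * (i == j)%:R); last by rewrite eq_sym (negPf ji) mulr0.
rewrite -(dual_basis hH i j hp) mulr_sumr; apply: eq_bigr => s _; ring.
Qed.

(** This governs the first-order term in [d] of the squared last residual; the reversed indexing of
    [probe] turns the pairing into [dotp]. *)
Lemma inner_ones_probe tau (k : nat) : (k <= n)%N ->
  inner v (act (phi k) (2^-1 *: ((probe tau : E) *m Z - probe tau) : E)) =
  - n.+1%:R * \sum_(j < n.+1) tau j * dotp (phi j) (phi k).
Proof.
move=> kn; set b := probe tau.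
have sk : (size (phi k) <= n.+1)%N by apply: leq_trans (size_phi H kn) _; lia.
have -> : 2^-1 *: (b *m Z - b) = - 2^-1 *: act (1 - 'X) b :> E.
  by rewrite actB act1 actX scaleNr -scalerN opprB.
rewrite actZr -actM [phi k * _]mulrC innerZr inner_ones_1subX //.
rewrite mulrA [- _ * 2]mulNr mulVf ?pnatr_eq0 // mulN1r mulNr; congr (- _).
rewrite mulr_sumr.
under eq_bigr => r _.
  rewrite mxE inordK ?ltnS ?leq_subr // subKn ?leq_ord // mulrA mulr_sumr.
  over.
rewrite exchange_big /=; apply: eq_bigr => j _.
rewrite !mulr_sumr; apply: eq_bigr => r _; ring.
Qed.

(* The operator [T = S o Z] with [S x = x - d min(<a, x>, 0) a] differs from [Z]
   at the single iterate [y_k] (for [d] small), so the last residual is exactly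
   [(2/N) v - d phi_k(Z) a]; its norm may not exceed that of [(2/N) v]. *)
Lemma probe_ge0 (tau : nat -> R) (k : nat) : (k < n)%N ->
  tau k = -1 -> (forall i, (i < k)%N -> 0 <= tau i) ->
  (forall i, (k < i)%N -> tau i = 1) ->
  \sum_(j < n.+1) tau j * dotp (phi j) (phi k) <= 0.
Proof.
move=> kn tauk taulo tauhi.
have [p hp] := poly_iterates_exists H.
(* [q] is the run from [0] with a unit error in the residual of step [k]; it vanishes up to [k]. *)
have [q [q0 hq]] := @traj_exists _ _ H _
  (fun j (q : {poly R}) => q - 'X * q + (j == k)%:R) 0.
pose a : E := 2^-1 *: ((probe tau : E) *m Z - probe tau).
pose K i := inner a (act (q i) a *m Z : E).
(* [d = 1/M] makes [d |a|^2] and every [d K_i] at most 1: the former for nonexpansiveness, the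
   latter to keep [<a, Z y_i>] nonnegative after step [k]. *)
pose M := 1 + inner a a + \sum_(i < n.+1) `|K i|.
have S0 : 0 <= \sum_(i < n.+1) `|K i| by apply: sumr_ge0.
have M1 : 1 <= M by have := inner_ge0 a; rewrite /M; lra.
have M0 : 0 < M by lra.
pose d := M^-1.
have d0 : 0 < d by rewrite invr_gt0.
have da : d * inner a a <= 1.
  by rewrite ler_pdivrMl // mulr1 /M; lra.
have dK (i : 'I_n.+1) : d * K i <= 1.
  rewrite ler_pdivrMl // mulr1; apply: le_trans (ler_norm _) _.
  have : `|K i| <= \sum_(i < n.+1) `|K i|.
    by rewrite (bigD1 i) //= lerDl sumr_ge0.
  by have := inner_ge0 a; rewrite /M; lra.
have qk i : (i <= k)%N -> q i = 0.
  elim/ltn_ind: i => -[//|i] IH ik.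
  have ln : (i < n)%N by lia.
  rewrite (hq (Ordinal ln)) [q (Ordinal ln)](IH i) //; last lia.
  rewrite big1 ?subrr // => j ji; have {}ji : (j <= i)%N by [].
  by rewrite IH ?mulr0 ?subrr ?add0r ?ltn_eqF ?scaler0 //; lia.
pose T (x : E) : E := (x *m Z : E) - (d * Num.min (inner a (x *m Z)) 0) *: a.
pose y i : E := act (p i) v - d *: act (q i) a.
(* The hinge is idle before [k], where [<a, Z y_i> = tau_i >= 0]; adds [d a] at [k], where the value
   is [-1]; and is idle later, where it is [1 - d K_i >= 0]. *)
have Ty (i : nat) : (i <= n)%N ->
    T (y i) = (y i *m Z : E) + (d * (i == k)%:R) *: a.
  move=> ni; rewrite /T.
  have iE : inner a (y i *m Z) = tau i - d * K i.
    rewrite /y mulmxBl -scalemxAl innerBr innerZr; congr (_ - _).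
    exact: (inner_probe tau (Ordinal (ni : (i < n.+1)%N)) hp).
  rewrite iE -scaleNr -mulrN; congr (_ + (_ * _) *: _).
  have [ik|ki|->] := ltngtP i k.
  - rewrite /K (qk i (ltnW ik)) act0 mul0mx inner0r mulr0 subr0.
    by rewrite min_r ?oppr0 //; apply: taulo.
  - rewrite min_r ?oppr0 // tauhi // subr_ge0.
    exact: (dK (Ordinal (ni : (i < n.+1)%N))).
  - rewrite /K (qk k) // act0 mul0mx inner0r mulr0 subr0 tauk.
    by rewrite min_l ?opprK ?lerN10.
have hy : @iterates R n.+1 H E T y.
  move=> i; rewrite {1}/y (hp.2 i) hq !actB !act_sum scalerBr.
  have -> : \sum_(j < n | (j <= i)%N) H i j *: (y j - T (y j)) =
     \sum_(j < n | (j <= i)%N) act (H i j *: (p j - 'X * p j)) v -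
     d *: \sum_(j < n | (j <= i)%N)
       act (H i j *: (q j - 'X * q j + (j == k :> nat)%:R)) a.
    rewrite scaler_sumr -sumrB; apply: eq_bigr => j ji.
    rewrite Ty; last by have := ltn_ord j; lia.
    rewrite !actZ actB [act (_ + _%:R) _]actD actB ![act ('X * _) _]actM.
    rewrite !actX /y mulmxBl -scalemxAl.
    have -> : act (j == k :> nat)%:R a = (j == k :> nat)%:R *: a.
      by case: (_ == _); rewrite ?act1 ?act0 ?scale1r ?scale0r.
    move: (act (p j) v *m Z) (act (q j) a *m Z) => w w'.
    by apply/rowP => s; rewrite !mxE; ring.
  by rewrite /y; apply/rowP => s; rewrite !mxE; ring.
have := Hstar_bound hH (@hinge_nonexpansive R n d a (ltW d0) da) _ hy.
rewrite -/(T 0) -/(T (y n)).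
have -> : T 0 = 0.
  by rewrite /T mul0mx inner0r min_l // mulr0 scale0r subr0.
have -> : y 0%N = v by rewrite /y q0 hp.1 act1 act0 scaler0 subr0.
move=> /(_ erefl erefl).
rewrite Ty // gtn_eqF // mulr0 scale0r addr0.
have resq : (1 - 'X) * q n = phi k.
  have := @response _ _ H q (fun j => (j == k)%:R).
  rewrite gtn_eqF // addr0 q0 mulr0 add0r => ->.
    rewrite (bigD1 (Ordinal (ltnW kn : (k < n.+1)%N))) //= eqxx mulr1.
    rewrite big1 ?addr0 // => j ne; rewrite -(inj_eq val_inj) /= in ne.
    by rewrite (negPf ne) mulr0.
  move=> i; rewrite hq; congr (_ - _); apply: eq_bigr => j _.
  by rewrite mulrBl mul1r.
have -> : y n - y n *m Z = (2 / n.+1%:R) *: v - d *: act (phi k) a.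
  rewrite -resq act_1subX -(act_Phi_ones hH) -(iterates_last hp) act_1subX.
  by rewrite /y mulmxBl -scalemxAl; apply/rowP => s; rewrite !mxE; ring.
rewrite !(innerBl, innerBr, innerZl, innerZr) (innerC _ v) inner_ones_ones.
rewrite inner_ones_probe ?(ltnW kn) //.
set S := \sum_(j < n.+1) _; have A0 := inner_ge0 (act (phi k) a).
move: (inner _ _) A0 => A A0.
have Nn0 : (n.+1%:R : R) != 0 by rewrite pnatr_eq0.
(* The bound leaves [4 d S + d^2 A <= 0] with [A >= 0], whence [S <= 0]. *)
rewrite (_ : _ - _ = 4 / n.+1%:R + 4 * d * S + d * (d * A)); last by field.
rewrite -addrA gerDl => h.
have dA : 0 <= d * (d * A) by rewrite !mulr_ge0 // ltW.
have : (4 * d) * S <= 0 by lra.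
by rewrite pmulr_rle0 // mulr_gt0.
Qed.

(* Let [tau_j] tend to infinity in [probe_ge0]. *)
Lemma dotp_phi_le0 (j k : nat) : (j < k)%N -> (k < n)%N ->
  dotp (phi j) (phi k) <= 0.
Proof.
move=> jk kn; rewrite leNgt; apply/negP => D0.
set D := dotp _ _ in D0.
pose tau B (i : nat) : R := if i == j then B else if i == k then -1 else
  if (k < i)%N then 1 else 0.
pose S := \sum_(i < n.+1 | i != j :> nat) tau 0 i * dotp (phi i) (phi k).
have jn : (j < n.+1)%N by lia.
have key B : 0 <= B -> B * D + S <= 0.
  move=> B0; have := @probe_ge0 (tau B) k kn.
  have tj : tau B j = B by rewrite /tau eqxx.
  rewrite (bigD1 (Ordinal jn)) //= tj -/D.
  rewrite (eq_bigl (fun i : 'I_n.+1 => i != j :> nat)) //.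
  rewrite (eq_bigr (fun i : 'I_n.+1 => tau 0 i * dotp (phi i) (phi k)));
    last first.
    by move=> i ij; rewrite /tau (negPf ij).
  apply.
  - by rewrite /tau gtn_eqF // eqxx.
  - move=> i ik; rewrite /tau; case: ifP => // _.
    by rewrite ltn_eqF // ltnNge (ltnW ik).
  - by move=> i ki; rewrite /tau !gtn_eqF // ?ki //; apply: ltn_trans ki.
(* For this [B], [B D + S = |S| + 1 + S > 0]. *)
have /key : 0 <= (`|S| + 1) / D by rewrite divr_ge0 ?addr_ge0 // ltW.
rewrite divfK ?gt_eqF // => h.
have := ler_norm (- S); rewrite normrN; lra.
Qed.

End Nonneg.

(** * Certificates as inner products, and their column and row sums *)

Lemma coef_exp_Xsub1 (R : comNzRingType) (l r : nat) :
  (('X - 1 : {poly R}) ^+ l)`_r = (-1) ^+ (l + r) * 'C(l, r)%:R.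
Proof.
elim: l r => [|l IH] r.
  rewrite expr0 coef1; case: r => [|r]; first by rewrite bin0 mulr1 expr0.
  by rewrite bin0n mulr0.
rewrite exprS mulrBl mul1r coefB coefXM (IH r); case: r => [|r] /=.
  by rewrite !bin0 !addn0 !mulr1 sub0r exprS mulN1r.
rewrite IH binS natrD !addnS addSn !exprS; ring.
Qed.

Lemma Vandermonde_diag (l m n : nat) : (m <= n)%N ->
  (\sum_(r < n.+1) 'C(l, r) * 'C(m, r) = 'C(l + m, m))%N.
Proof.
move=> mn; rewrite -binomial.Vandermonde.
rewrite (big_ord_widen n.+1 (fun r => 'C(l, r) * 'C(m, m - r))%N) ?ltnS //.
rewrite [RHS]big_mkcond; apply: eq_bigr => r _; rewrite ltnS.
have [rm|mr] := leqP r m; first by rewrite bin_sub.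
by rewrite (bin_small mr) muln0.
Qed.

Section Dotp.
Variables (R : realType) (n : nat).
Local Notation dotp := (@dotp R n).
Implicit Types p q : {poly R}.

Lemma dotpC p q : dotp p q = dotp q p.
Proof. by apply: eq_bigr => i _; rewrite mulrC. Qed.

Lemma dotp_sumr (I : Type) (s : seq I) (P : pred I) (F : I -> {poly R}) p :
  dotp p (\sum_(i <- s | P i) F i) = \sum_(i <- s | P i) dotp p (F i).
Proof.
rewrite /dotp exchange_big /=; apply: eq_bigr => r _.
by rewrite coef_sum mulr_sumr.
Qed.

Lemma dotpZr c p q : dotp p (c *: q) = c * dotp p q.
Proof.
by rewrite /dotp mulr_sumr; apply: eq_bigr => r _; rewrite coefZ mulrCA.
Qed.

Lemma dotp1 p : dotp p 1 = p`_0.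
Proof.
rewrite /dotp big_ord_recl coef1 mulr1 big1 ?addr0 // => i _.
by rewrite coef1 mulr0.
Qed.

Lemma dotp_Xn p (r : nat) : (r <= n)%N -> dotp p 'X^r = p`_r.
Proof.
move=> rn; rewrite /dotp (bigD1 (Ordinal (rn : (r < n.+1)%N))) //=.
rewrite coefXn eqxx mulr1 big1 ?addr0 // => i ne.
by rewrite -(inj_eq val_inj) /= in ne; rewrite coefXn (negPf ne) mulr0.
Qed.

Lemma dotp_exp_Xsub1 l m : (m <= n)%N ->
  dotp (('X - 1) ^+ l) (('X - 1) ^+ m) = (-1) ^+ (l + m) * 'C(l + m, m)%:R.
Proof.
move=> mn; rewrite -(Vandermonde_diag l mn) natr_sum mulr_sumr.
apply: eq_bigr => r _; rewrite !coef_exp_Xsub1 natrM !exprD.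
rewrite mulrACA [_ * (-1) ^+ r * _](_ : _ = (-1) ^+ l * (-1) ^+ m) //.
by rewrite mulrACA -[(-1) ^+ r * _]expr2 sqrr_sign mulr1.
Qed.

Variable H : 'M[R]_n.
Local Notation phi := (phi H).
Local Notation cert := (@hcert R n.+1 H).

(** [hcert] counts from 1, [phi] from 0. For [k = n] only the constant coefficient of [phi j]
    enters; otherwise expand both factors in powers of ['X - 1]. *)
Lemma hcert_dotp (j k : nat) : (j < n)%N -> (k <= n)%N ->
  cert k.+1 j.+1 = - n.+1%:R * dotp (phi j) (phi k).
Proof.
move=> jn kn; rewrite /hcert eqSS mulNr -mulrN.
have [->|nk] := eqVneq k n.
  rewrite phi_last dotp1 -[phi j]/(phi (Ordinal jn)) phiE coef_sum -sumrN.
  congr (_ * _); rewrite big_add1 big_mkord.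
  apply: eq_bigr => m _.
  rewrite coefZ coef_exp_Xsub1 bin0 mulr1 addn0 subn1 /= exprS.
  by rewrite mulN1r mulrN opprK mulrC.
have {nk}kn' : (k < n)%N by rewrite ltn_neqAle nk.
rewrite -[phi j]/(phi (Ordinal jn)) -[phi k]/(phi (Ordinal kn')) !phiE.
congr (_ * _); rewrite dotpC dotp_sumr -sumrN big_add1 big_mkord.
apply: eq_bigr => l _.
rewrite dotpZr dotpC dotp_sumr -mulrN -sumrN mulr_sumr big_add1 big_mkord.
apply: eq_bigr => m _; rewrite dotpZr.
rewrite dotp_exp_Xsub1 ?(leq_trans _ (ltn_ord m)) //.
rewrite [in LHS]addSn subn1 /= [in RHS]addSn exprS; ring.
Qed.

Hypothesis hH : @Hstar R n.+1 H.

Lemma hcert_ge0 (j k : nat) : (j < k)%N -> (k < n)%N -> 0 <= cert k.+1 j.+1.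
Proof.
move=> jk kn; rewrite hcert_dotp ?(ltnW kn) //; last exact: ltn_trans kn.
by rewrite mulNr -mulrN mulr_ge0 // oppr_ge0 (dotp_phi_le0 hH).
Qed.

Lemma sum_phi0 : \sum_(j < n) (phi j)`_0 = n.+1%:R^-1 - 1.
Proof.
rewrite -(coef_Phi hH (leq0n n)) coef_sum big_ord_recr /= phi_last coef1.
by rewrite addrK.
Qed.

Lemma sum_hcert_last : \sum_(j < n) cert n.+1 j.+1 = n%:R.
Proof.
rewrite (eq_bigr (fun j : 'I_n => - n.+1%:R * (phi j)`_0)); last first.
  by move=> j _; rewrite hcert_dotp // phi_last dotp1.
rewrite -mulr_sumr sum_phi0 mulNr mulrBr mulfV ?pnatr_eq0 // mulr1 opprB.
by rewrite -[n.+1]addn1 natrD addrK.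
Qed.

(* By orthogonality [phi_nu] is [alpha (1 + ... + z^(d-1)) - d alpha z^d], and
   [alpha] is found by evaluating [\sum_(k > nu) phi_k] at [1]. *)
Lemma sum_hcert_decomposable (nu : nat) : @decomposable_at R n.+1 H nu.+1 ->
  \sum_(j < nu) cert nu.+1 j.+1 = nu.+1%:R * nu%:R / n.+1%:R.
Proof.
case=> _ nun [_ certnu] certlo.
have {}nun : (nu < n)%N by lia.
have Nn0 : (n.+1%:R : R) != 0 by rewrite pnatr_eq0.
pose d := (n - nu)%N.
have dn0 : (d%:R : R) != 0 by rewrite pnatr_eq0 /d; lia.
have dE : n%:R = d%:R + nu%:R :> R by rewrite -natrD /d subnK ?(ltnW nun).
have NE : n.+1%:R = d%:R + nu%:R + 1 :> R by rewrite -natr1 dE.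
have dotp_lo j k : (j < nu)%N -> (nu < k <= n)%N -> dotp (phi j) (phi k) = 0.
  move=> jnu /andP[nuk kn]; have := certlo j.+1 k.+1.
  rewrite hcert_dotp //; last lia.
  by move=> h; apply/eqP; have /eqP := h ltac:(lia) ltac:(lia);
    rewrite mulf_eq0 oppr_eq0 (negPf Nn0).
have dotp_nu k : (nu < k < n)%N -> dotp (phi nu) (phi k) = 0.
  move=> nukn; have := certnu k.+1; rewrite hcert_dotp //; last lia.
  by move=> h; apply/eqP; have /eqP := h ltac:(lia);
    rewrite mulf_eq0 oppr_eq0 (negPf Nn0).
have [p hp] := poly_iterates_exists H.
have pn s : (s <= n)%N -> (p n)`_s = n.+1%:R^-1.
  suff -> : p n = Phi H by apply: coef_Phi.
  apply: (@mulfI _ (1 - 'X : {poly R})); last exact: iterates_last.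
  by rewrite -opprB oppr_eq0 polyXsubC_eq0.
(* [iterates_phi] expands [X^r] in the [phi k]. As [p k] has degree at most [k], only [k >= n - r]
   contribute, hence only [k > nu] when [r < d]. *)
have coef_phi j r : (r <= n)%N ->
    (phi j)`_r =
    n.+1%:R * \sum_(k < n.+1) (p k)`_(n - r) * dotp (phi j) (phi k).
  move=> rn; rewrite -(dotp_Xn (phi j) rn).
  under eq_bigr => k _ do rewrite -dotpZr.
  rewrite -dotp_sumr -dotpZr (iterates_phi hp (PhiE hH)) ?leq_subr //.
  by rewrite subKn // scalerA mulfV // scale1r.
have p_small (k : 'I_n.+1) r : (k + r < n)%N -> (p k)`_(n - r) = 0.
  move=> kr; apply: nth_default; apply: leq_trans (size_iterates hp _) _; lia.
have phi_lo j r : (j < nu)%N -> (r < d)%N -> (phi j)`_r = 0.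
  rewrite /d => jnu rd; rewrite coef_phi; last lia.
  rewrite big1 ?mulr0 // => k _; have [h|h] := ltnP (k + r) n.
    by rewrite p_small // mul0r.
  by rewrite dotp_lo ?mulr0 //; have := ltn_ord k; lia.
pose alpha := (phi nu)`_0.
(* Among [k > nu] only [k = n] is not orthogonal by hypothesis; its weight is [N (1/N) = 1]. *)
have phi_nu r : (r < d)%N -> (phi nu)`_r = alpha.
  rewrite /d => rd; rewrite coef_phi; last lia.
  rewrite big_ord_recr /= big1 ?add0r.
    by rewrite pn ?leq_subr // phi_last dotp1 mulrA mulfV // mul1r.
  move=> k _; have [h|h] := ltnP (k + r) n.
    by rewrite (p_small (widen_ord (leqnSn n) k)) // mul0r.
  by rewrite dotp_nu ?mulr0 //; have := ltn_ord k; lia.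
have size_nu : (size (phi nu) <= d.+1)%N.
  by apply: leq_trans (size_phi H (ltnW nun)) _; rewrite /d; lia.
have phi_nud : (phi nu)`_d = - (d%:R * alpha).
  have := phi1 H nun; rewrite (horner_coef_wide 1 size_nu) big_ord_recr /=.
  rewrite expr1n mulr1 (eq_bigr (fun=> alpha)).
    rewrite sumr_const card_ord -[alpha *+ _]mulr_natl => /eqP.
    by rewrite addrC addr_eq0 => /eqP.
  by move=> r _; rewrite expr1n mulr1 phi_nu.
have alphaE : alpha = n.+1%:R^-1 - d%:R^-1.
  (* Below degree [d], the coefficients [1/N] of [Phi] come from [phi nu] and [tail] alone; as
     [tail] has degree below [d] and [tail(1) = 1], this gives [d (1/N - alpha) = 1]. *)
  pose tail := \sum_(k < n.+1 | (nu < k)%N) phi k.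
  have size_tail : (size tail <= d)%N.
    apply: leq_trans (size_sum _ _ _) _; apply/bigmax_leqP => k nuk.
    apply: leq_trans (size_phi H _) _; first by rewrite -ltnS.
    by rewrite /d; have := ltn_ord k; lia.
  have tail1 : tail.[1] = 1.
    rewrite /tail big_mkcond big_ord_recr /= nun hornerD phi_last hornerC.
    rewrite horner_sum big1 ?add0r // => k _.
    by case: ifP => _; rewrite ?horner0 // phi1.
  have coef_tail r : (r < d)%N -> tail`_r = n.+1%:R^-1 - alpha.
    rewrite /d => rd; rewrite -(coef_Phi hH (_ : (r <= n)%N)); last lia.
    rewrite -(phi_nu r) //; apply/esym/eqP; rewrite subr_eq /Phi !coef_sum.
    rewrite (bigID (fun k : 'I_n.+1 => (nu < k)%N)) /=.
    have nun1 : (nu < n.+1)%N by lia.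
    rewrite [X in _ + X](bigD1 (Ordinal nun1)) /= ?ltnn //.
    rewrite [X in _ + (_ + X)]big1 ?addr0 // => k /andP[nuk ne].
    rewrite -(inj_eq val_inj) /= in ne.
    by apply: phi_lo => //; lia.
  have : d%:R * (n.+1%:R^-1 - alpha) = 1.
    rewrite -[RHS]tail1 (horner_coef_wide 1 size_tail).
    rewrite (eq_bigr (fun=> n.+1%:R^-1 - alpha)).
      by rewrite sumr_const card_ord mulr_natl.
    by move=> r _; rewrite expr1n mulr1 coef_tail.
  move=> h; have -> : d%:R^-1 = n.+1%:R^-1 - alpha.
    by apply: (mulfI dn0); rewrite h mulfV.
  by rewrite subKr.
have dotp_nunu : dotp (phi nu) (phi nu) =
    d%:R * alpha ^+ 2 + (d%:R * alpha) ^+ 2.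
  rewrite /dotp.
  rewrite -(@big_mkord _ _ _ _ xpredT (fun r => (phi nu)`_r * (phi nu)`_r)).
  rewrite (@big_cat_nat _ _ _ d.+1) //=; last by rewrite /d; lia.
  rewrite [X in _ + X]big_nat_cond [X in _ + X]big1 ?addr0.
    rewrite big_mkord big_ord_recr /= phi_nud mulrNN -expr2; congr (_ + _).
    rewrite (eq_bigr (fun=> alpha ^+ 2)).
      by rewrite sumr_const card_ord mulr_natl.
    by move=> r _; rewrite phi_nu.
  move=> r /andP[/andP[dr _] _].
  by rewrite (nth_default _ (leq_trans size_nu dr)) mul0r.
(* The coefficients of [Phi] all equal [1/N], so this is [phi_nu(1) / N]. *)
have dotp_Phi : dotp (phi nu) (Phi H) = 0.
  have -> : 0 = n.+1%:R^-1 * (phi nu).[1] by rewrite phi1 // mulr0.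
  have sn : (size (phi nu) <= n.+1)%N.
    by apply: leq_trans size_nu _; rewrite /d; lia.
  rewrite (horner_coef_wide 1 sn) mulr_sumr; apply: eq_bigr => r _.
  by rewrite (coef_Phi hH) ?leq_ord // expr1n mulr1 mulrC.
(* Split [Phi] at [nu]: the indices strictly between [nu] and [n] drop out, and [n] contributes
   [alpha]. *)
have sum_lo : \sum_(j < nu) dotp (phi nu) (phi j) =
    - dotp (phi nu) (phi nu) - alpha.
  have := dotp_Phi.
  rewrite /Phi dotp_sumr big_ord_recr /= phi_last dotp1 -/alpha.
  rewrite -(@big_mkord _ _ _ _ xpredT (fun j => dotp (phi nu) (phi j))).
  rewrite (@big_cat_nat _ _ _ nu) //=; last exact: ltnW.
  rewrite [X in _ + X + _]big_ltn // [X in _ + (_ + X) + _]big_nat_cond.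
  rewrite [X in _ + (_ + X) + _]big1; last by move=> k /andP[/dotp_nu].
  by rewrite big_mkord addr0 -addrA => /eqP; rewrite addr_eq0 opprD => /eqP.
rewrite (eq_bigr (fun j : 'I_nu => - n.+1%:R * dotp (phi nu) (phi j)));
  last first.
  move=> j _; rewrite hcert_dotp 1?dotpC //; last exact: ltnW.
  by apply: leq_trans (ltn_ord j) (ltnW nun).
rewrite -mulr_sumr sum_lo dotp_nunu alphaE -[nu.+1]addn1 natrD NE.
rewrite NE in Nn0; field.
by rewrite dn0 Nn0.
Qed.

End Dotp.

Theorem proposition7 (R : realType) (N N' : nat) (hN : (1 <= N)%N)
    (hN' : (1 <= N' <= N - 1)%N) (H : 'M[R]_(N.-1))
    (Hvertex : vertex H) (Hdec : decomposable_at H N') :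
  rho H >= (N%:R - 1) + N'%:R * (N'%:R - 1) / N%:R.
Proof.
case: N hN H hN' Hvertex Hdec => // n _ H hN' [hH _].
case: N' hN' => // nu hN' Hdec.
have nun : (nu < n)%N by lia.
have succB1 (m : nat) : m.+1%:R - 1 = m%:R :> R by rewrite -natr1 addrK.
rewrite !succB1.
(* Both terms of the bound become sums of certificates over [j], so columns can be compared one by
   one. *)
rewrite -[X in X + _](sum_hcert_last hH) -(sum_hcert_decomposable hH Hdec).
rewrite /rho big_add1 big_mkord.
rewrite (big_ord_widen n (fun j => hcert H nu.+1 j.+1)) ?(ltnW nun) //.
rewrite [X in _ + X]big_mkcond -big_split /=; apply: ler_sum => j _.
rewrite big_nat_recr /=; last exact: ltn_ord.
rewrite addrC lerD2r.
have nonneg (k : nat) : (j.+2 <= k < n.+1)%N -> 0 <= hcert H k j.+1.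
  by case: k => // k jkn; apply: (hcert_ge0 hH); lia.
case: ifP => jnu; last by rewrite big_nat_cond sumr_ge0 // => k /andP[/nonneg].
(* For [j < nu] the row [nu.+1] supplies the extra term; the other rows before the last are
   nonnegative. *)
rewrite (@big_cat_nat _ _ _ nu.+1) //=; last by lia.
rewrite [X in _ + X]big_ltn; last lia.
rewrite addrCA lerDl addr_ge0 // big_nat_cond sumr_ge0 // => k /andP[kb _].
  by apply: nonneg; lia.
by apply: nonneg; lia.
Qed.
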